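(* Let $K$ be a field over which the polynomial $t^2+1$ does not split, and let $L=K(\mathrm{i})$ with $\mathrm{i}^2=-1$. Let $d$ be a positive integer with $d\equiv 8\bmod \operatorname{char}K$ (if $\operatorname{char}K=0$, this means $d=8$). Let $H\in K^{d\times d}$ be any modular Hadamard matrix, i.e. $H_{ij}^2=1$ for all $i,j\in[d]$ and $H^\top H=dI$, and let $h_j\in K^d$ denote the $j$th column of $H$. Then the $d^2$ vectors $\{x_{ij}\}_{i,j\in[d]}$ in $L^d$ defined by \[ x_{ij}=h_j\circ(\mathbf{1}+ze_i),\qquad z:=-2(1+\mathrm{i}), \] where $\circ$ denotes the entrywise (Hadamard) product, form a $(12,16,96)$-SIC.
   Context: Let $K$ be a field over which $t^2+1$ does not split (so in particular $\operatorname{char}K\neq2$), and let $L$ be the extension of $K$ obtained by adjoining a root $\mathrm{i}$ of $t^2+1$. The conjugate of $a+b\mathrm{i}\in L$ ($a,b\in K$) is $\overline{a+b\mathrm{i}}=a-b\mathrm{i}$. For a column vector $x\in L^d$, $x^*$ is its conjugate transpose, and $(x,y)=x^*y$ is a sesquilinear form on $L^d$. Notation: $[d]=\{1,\dots,d\}$; $I$ is the $d\times d$ identity matrix; $e_i$ is its $i$th column; $\mathbf{1}=\sum_{i\in[d]}e_i$. Definition. Given $a,b,c\in K$ with $a^2\neq b$, and a set $X$ of cardinality $d^2$, a tuple $\{x_i\}_{i\in X}$ of vectors $x_i\in L^d$ forms an $(a,b,c)$-SIC if: (a) $(x_i,x_i)=a$ for all $i\in X$; (b) $(x_i,x_j)(x_j,x_i)=b$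 for all $i,j\in X$ with $i\neq j$; (c) $\sum_{i\in X}x_ix_i^*=cI$; and (d) $\operatorname{span}\{x_i:i\in X\}=L^d$. (Integers are interpreted as elements of $K$ in the usual way.) *)

(* Defs.v *)
From HB Require Import structures.
From mathcomp Require Import all_boot all_order all_fingroup all_algebra all_field.

Set Implicit Arguments.
Unset Strict Implicit.
Unset Printing Implicit Defensive.

Import GRing.Theory.
Local Open Scope ring_scope.

(* Characteristic 0 is included. Since m %% 0 = m, the congruence
   [m = n %[mod p]] then means [m = n]. *)
Definition is_char (K : fieldType) (p : nat) : Prop :=
  if p is 0%N then [pchar K] =i pred0 else p \in [pchar K].

Definition splits (K : fieldType) (q : {poly K}) : Prop :=
  exists rs : seq K, q %= \prod_(r <- rs) ('X - r%:P).

Definition modular_hadamard (K : fieldType) (d : nat) (H : 'M[K]_d) : Prop :=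
  (forall i j, H i j ^+ 2 = 1) /\ H^T *m H = d%:R%:M.

Definition adjoins_sqrtN1 (K : fieldType) (L : fieldExtType K) (im : L) : Prop :=
  im ^+ 2 = -1 /\ <<1; im>>%VS = {:L}%VS.

(* The coordinates are those in the basis (1, im) of L over K, so this sends
   a + b im to a - b im; see conjE. *)
Definition conj (K : fieldType) (L : fieldExtType K) (im x : L) : L :=
  let B := [tuple 1; im] in
  (coord B ord0 x)%:A - coord B ord_max x *: im.

Lemma conjE (K : fieldType) (L : fieldExtType K) (im : L) :
  ~ splits ('X^2 + 1 : {poly K}) -> adjoins_sqrtN1 im ->
  forall a b : K, conj im (a%:A + b *: im) = a%:A - b *: im.
Proof.
move=> nsp [im2 _] a b.
have fB : free [tuple 1; im].
  rewrite /= free_cons seq1_free span_seq1; apply/andP; split; last first.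
    apply/eqP => im0; move/eqP: im2; rewrite im0 expr0n /= eq_sym oppr_eq0.
    by rewrite oner_eq0.
  apply/negP => /vlineP [k E1].
  have k2 : k ^+ 2 = -1.
    have /eqP : (1 : L) ^+ 2 = (k *: im) ^+ 2 by rewrite -E1.
    rewrite expr1n exprZn im2 scalerN -[X in X == _]scale1r -subr_eq0 opprK.
    rewrite -scalerDl scaler_eq0 oner_eq0 orbF addrC addr_eq0.
    by move/eqP.
  apply: nsp; exists [:: k; - k].
  rewrite big_cons big_seq1 polyCN opprK -subr_sqr -polyC_exp k2 polyCN opprK.
  exact: eqpxx.
set B := [tuple 1; im].
have E0 j : coord B j 1 = (ord0 == j)%:R.
  by rewrite -(coord_free ord0 j fB).
have E1 j : coord B j im = (ord_max == j)%:R.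
  by rewrite -(coord_free ord_max j fB).
by rewrite /conj -/B !linearD !linearZ /= !E0 !E1 /= !mulr1 !mulr0 addr0 add0r.
Qed.

Definition conj_trmx (K : fieldType) (L : fieldExtType K) (im : L) (m n : nat)
  (A : 'M[L]_(m, n)) : 'M[L]_(n, m) := (map_mx (conj im) A)^T.

Definition form (K : fieldType) (L : fieldExtType K) (im : L) (d : nat)
  (x y : 'cV[L]_d) : L := (conj_trmx im x *m y) 0 0.

Record is_SIC (K : fieldType) (L : fieldExtType K) (im : L) (d : nat)
    (a b c : K) (X : finType) (x : X -> 'cV[L]_d) : Prop := IsSIC {
  SIC_param : a ^+ 2 != b;
  SIC_card : #|X| = (d ^ 2)%N;
  SIC_norm : forall i, form im (x i) (x i) = a%:A;
  SIC_equiangular : forall i j, i != j ->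
    form im (x i) (x j) * form im (x j) (x i) = b%:A;
  SIC_tight : \sum_i x i *m conj_trmx im (x i) = (c%:A)%:M;
  SIC_span : <<codom x>>%VS = {: 'cV[L]_d}%VS
}.

Definition hadamard_prod (R : nzRingType) (d : nat) (u v : 'cV[R]_d) : 'cV[R]_d :=
  map2_mx *%R u v.

Definition SIC_vec (K : fieldType) (L : fieldExtType K) (im : L) (d : nat)
    (H : 'M[K]_d) (i j : 'I_d) : 'cV[L]_d :=
  let z := - 2 * (1 + im) in
  hadamard_prod (map_mx (in_alg L) (col j H)) (const_mx 1 + z *: delta_mx i 0).

(* Main.v *)
Require Import Defs.
From HB Require Import structures.
From mathcomp Require Import all_boot all_order all_fingroup all_algebra all_field.
From mathcomp Require Import ring.

Set Implicit Arguments.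
Unset Strict Implicit.
Unset Printing Implicit Defensive.

Import GRing.Theory.
Local Open Scope ring_scope.

(** With [z = - 2 (1 + i)] and [w] its conjugate, the constants of the theorem
    come from four identities: [z + w = - 4], [z w = 8], [z ^ 2 + w ^ 2 = 0] and,
    by the congruence on [d], [d = 8] in [K].

    The vector [x_ij] is the [j]-th column of the real matrix [H] with its
    [i]-th entry multiplied by [1 + z], so an inner product of two such vectors
    is a sum of the products [g_k = H_kj H_kj'] perturbed at two indices.
    [sum_perturb] expands it, with [s = g_i] and [t = g_i'] (signs):
      [(x_ij, x_i'j') = d [j = j'] + w s + z t + [i = i'] z w s].
    This is [8 - 4 + 8 = 12] when the vectors have the same index, [8 - 4 = 4]
    when only [i <> i'], and [s (8 - 4)], hence [4] or [- 4], when only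
    [j <> j'].  When both indices differ, the product of [w s + z t] with its
    conjugate is [2 z w + s t (z ^ 2 + w ^ 2) = 16]; it is here that the
    vanishing of [z ^ 2 + w ^ 2] matters.

    For the tight frame condition, [H] also has orthogonal rows because [d] is
    invertible; summing over [j] first kills the off-diagonal entries, and the
    same expansion gives [8 (8 - 4 + 8) = 96] on the diagonal.

    Spanning does not follow from tightness, since [96] vanishes in
    characteristic [3].  Instead, the vectors with one fixed [i] are already a
    basis: they are the columns of [H] after an invertible diagonal scaling,
    as [1 + z] is nonzero. *)

(** * Consequences of the hypotheses on the field *)

(** In characteristic [2] the polynomial is [(t - 1) ^ 2]. *)
Lemma nonsplit_two_neq0 (K : fieldType) :
  ~ splits ('X^2 + 1 : {poly K}) -> (2 : K) != 0.
Proof.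
move=> nsp; apply/eqP => two0; apply: nsp; exists [:: 1; 1].
rewrite big_cons big_seq1.
have -> : ('X - 1%:P) * ('X - 1%:P) = 'X^2 + 1 - 2%:P * 'X :> {poly K}.
  by rewrite (_ : 2%:P = 2 :> {poly K}) ?polyC_natr //; ring.
by rewrite two0 mul0r subr0 eqpxx.
Qed.

(** In characteristic [5], the elements [2] and [- 2] are the roots. *)
Lemma nonsplit_five_neq0 (K : fieldType) :
  ~ splits ('X^2 + 1 : {poly K}) -> (5 : K) != 0.
Proof.
move=> nsp; apply/eqP => five0; apply: nsp; exists [:: 2; - 2].
rewrite big_cons big_seq1.
have -> : ('X - 2%:P) * ('X - (- 2)%:P) = 'X^2 + 1 - 5%:P :> {poly K}.
  by rewrite polyCN !polyC_natr; ring.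
by rewrite five0 subr0 eqpxx.
Qed.

Lemma natr_eq_mod_char (K : fieldType) (p m n : nat) :
  is_char K p -> m = n %[mod p] -> m%:R = n%:R :> K.
Proof.
case: p => [|p] charKp eq_mn; first by rewrite !modn0 in eq_mn; rewrite eq_mn.
have modE k : k%:R = (k %% p.+1)%:R :> K.
  by rewrite {1}(divn_eq k p.+1) natrD natrM (pcharf0 charKp) mulr0 add0r.
by rewrite modE eq_mn -modE.
Qed.

(** * Matrices and perturbed sums *)

(** The sum of [g] in which the terms at [i] and [i'] have been rescaled; it
    computes both inner products (sum over coordinates) and the diagonal of the
    frame operator (sum over vectors). *)
Lemma sum_perturb (R : comNzRingType) (d : nat) (g : 'I_d -> R) (i i' : 'I_d)
    (w z : R) :
  \sum_k g k * (1 + (k == i)%:R * w) * (1 + (k == i')%:R * z)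
    = \sum_k g k + g i * w + g i' * z + (i == i')%:R * (g i * w * z).
Proof.
have pick (F : 'I_d -> R) l : \sum_k (k == l)%:R * F k = F l.
  rewrite (bigD1 l) //= eqxx mul1r big1 ?addr0 // => k /negPf->.
  by rewrite mul0r.
rewrite -(pick (fun k => (k == i')%:R * (g k * w * z)) i).
rewrite -(pick (fun k => g k * w) i) -(pick (fun k => g k * z) i').
by rewrite -!big_split /=; apply: eq_bigr => k _; ring.
Qed.

(** Up to the scalar [a], the transpose is a left inverse of [H], hence also a
    right inverse. *)
Lemma orthogonal_cols_rows (F : fieldType) (d : nat) (H : 'M[F]_d) (a : F) :
  a != 0 -> H^T *m H = a%:M -> H *m H^T = a%:M.
Proof.
move=> a0 orth; have: (a^-1 *: H^T) *m H = 1%:M.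
  by rewrite -scalemxAl orth scale_scalar_mx mulVf.
move/mulmx1C; rewrite -scalemxAr => /(congr1 ( *:%R a)).
by rewrite scalerA divff // scale1r scale_scalar_mx mulr1.
Qed.

(** This lets spanning be read off from a factorization of the matrix of the
    vectors into invertible factors. *)
Lemma unitmx_cols_span (F : fieldType) (d : nat) (M : 'M[F]_d)
    (U : {vspace 'cV[F]_d}) :
  M \in unitmx -> (forall j, col j M \in U) -> U = fullv.
Proof.
move=> Munit colU; apply/vspaceP => v; rewrite memvf.
rewrite -[v](mulKVmx Munit); set c := invmx M *m v.
have -> : M *m c = \sum_j c j 0 *: col j M.
  apply/matrixP => k l; rewrite (ord1 l) !mxE summxE.
  by apply: eq_bigr => j _; rewrite !mxE mulrC.
by apply: memv_suml => j _; apply: memvZ.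
Qed.

(** * The vectors *)

Section Vectors.
Variables (K : fieldType) (L : fieldExtType K) (im : L) (d : nat) (H : 'M[K]_d).
Hypotheses (nsp : ~ splits ('X^2 + 1 : {poly K})) (adj : adjoins_sqrtN1 im).
Hypotheses (d8 : d%:R = 8 :> K) (hadH : modular_hadamard H).

Let G : 'M[L]_d := map_mx (in_alg L) H.
Let z : L := - 2 * (1 + im).
Let w : L := - 2 * (1 - im).

Let d8L : d%:R = 8 :> L.
Proof. by rewrite -(rmorph_nat (in_alg L)) d8 rmorph_nat. Qed.

Let im2 : im ^+ 2 = -1. Proof. by case: adj. Qed.

Let addzw : z + w = - 4. Proof. by rewrite /z /w; ring. Qed.

Let mulzw : z * w = 8.
Proof.
rewrite (_ : z * w = 4 * (1 - im ^+ 2)); last by rewrite /z /w; ring.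
by rewrite im2; ring.
Qed.

Let addzw2 : z ^+ 2 + w ^+ 2 = 0.
Proof.
rewrite (_ : _ + _ = 8 * (1 + im ^+ 2)); last by rewrite /z /w; ring.
by rewrite im2; ring.
Qed.

Let natL_neq0 n : (n%:R : K) != 0 -> (n%:R : L) != 0.
Proof. by rewrite -(rmorph_nat (in_alg L)) fmorph_eq0. Qed.

Let eight_neq0 (F : fieldType) : (2 : F) != 0 -> (8 : F) != 0.
Proof.
by move=> two0; rewrite (_ : 8 = 2 ^+ 3 :> F) ?expf_neq0 //; ring.
Qed.

Let d_neq0 : (d%:R : L) != 0.
Proof. by rewrite d8L eight_neq0 ?natL_neq0 ?nonsplit_two_neq0. Qed.

(** The norm of [1 + z] over [K] is [1 + (z + w) + z w = 5]. *)
Lemma one_plus_z_neq0 : 1 + z != 0.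
Proof.
apply: contraNneq (natL_neq0 (nonsplit_five_neq0 nsp)) => z1.
have -> : (5 : L) = (1 + z) * (1 + w).
  rewrite (_ : _ * _ = 1 + (z + w) + z * w); last by ring.
  by rewrite addzw mulzw; ring.
by rewrite z1 mul0r.
Qed.

Let Gsq k j : G k j ^+ 2 = 1.
Proof. by rewrite mxE -rmorphXn (proj1 hadH) rmorph1. Qed.

Let Gcols : G^T *m G = d%:R%:M.
Proof.
by rewrite /G map_trmx -map_mxM (proj2 hadH) map_scalar_mx rmorph_nat.
Qed.

Let Grows : G *m G^T = d%:R%:M.
Proof. exact: orthogonal_cols_rows d_neq0 Gcols. Qed.

Let sumG_cols j j' : \sum_k G k j * G k j' = d%:R *+ (j == j').
Proof.
have /matrixP/(_ j j') := Gcols; rewrite !mxE => <-.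
by apply: eq_bigr => k _; rewrite [_^T _ _]mxE.
Qed.

Let sumG_rows k l : \sum_j G k j * G l j = d%:R *+ (k == l).
Proof.
have /matrixP/(_ k l) := Grows; rewrite !mxE => <-.
by apply: eq_bigr => j _; rewrite [_^T _ _]mxE.
Qed.

Lemma SIC_vecE i j k :
  SIC_vec im H i j k 0 = G k j * (1 + (k == i)%:R * z).
Proof. by rewrite !mxE eqxx andbT [_ * (k == i)%:R]mulrC. Qed.

(** Conjugation replaces [z] by [w].  Each entry is put in the form
    [a%:A + b *: im], the only one on which [conjE] evaluates conjugation, with
    [b] the coefficient contributed by [z] and [a = H k j + b], since [z] has
    equal real and imaginary parts. *)
Lemma conj_SIC_vecE i j k :
  conj im (SIC_vec im H i j k 0) = G k j * (1 + (k == i)%:R * w).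
Proof.
pose e : K := (k == i)%:R; pose b := - 2 * H k j * e.
have eE : e%:A = (k == i)%:R :> L by rewrite -in_algE rmorph_nat.
have twoE : 2%:A = 2 :> L by rewrite -in_algE rmorph_nat.
have bE : b%:A = - 2 * G k j * (k == i)%:R.
  by rewrite -!in_algE !rmorphM rmorphN /= twoE eE mxE.
have aE : (H k j + b)%:A = G k j + b%:A by rewrite scalerDl mxE.
have scaleE x : x *: im = x%:A * im by rewrite mulr_algl.
have -> : SIC_vec im H i j k 0 = (H k j + b)%:A + b *: im.
  by rewrite SIC_vecE aE scaleE bE /z; ring.
by rewrite conjE // aE scaleE bE /w; ring.
Qed.

Lemma form_SIC_vec i j i' j' :
  Defs.form im (SIC_vec im H i j) (SIC_vec im H i' j')
    = d%:R *+ (j == j') + G i j * G i j' * w + G i' j * G i' j' * z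
      + (i == i')%:R * (G i j * G i j' * w * z).
Proof.
rewrite -sumG_cols -(@sum_perturb _ _ (fun k => G k j * G k j')).
rewrite [LHS]mxE; apply: eq_bigr => k _.
rewrite SIC_vecE [X in X * _]mxE [X in X * _]mxE conj_SIC_vecE.
ring.
Qed.

Let natA n : n%:R%:A = n%:R :> L.
Proof. by rewrite -in_algE rmorph_nat. Qed.

Lemma SIC_vec_norm i j :
  Defs.form im (SIC_vec im H i j) (SIC_vec im H i j) = 12%:A.
Proof.
rewrite form_SIC_vec !eqxx /= mulr1n -expr2 Gsq d8L natA.
rewrite (_ : _ + _ = 8 + (z + w) + z * w); last by ring.
by rewrite addzw mulzw; ring.
Qed.

Lemma SIC_vec_equiangular i j i' j' : (i, j) != (i', j') ->
  Defs.form im (SIC_vec im H i j) (SIC_vec im H i' j')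
    * Defs.form im (SIC_vec im H i' j') (SIC_vec im H i j) = 16%:A.
Proof.
rewrite xpair_eqE negb_and !form_SIC_vec natA d8L.
rewrite [j' == j]eq_sym [i' == i]eq_sym [G i' j' * _]mulrC [G i j' * _]mulrC.
have sq k l l' : (G k l * G k l') ^+ 2 = 1 by rewrite exprMn !Gsq mulr1.
have [<-{i'}|_] := eqVneq i i'; have [<-{j'}|_] //= := eqVneq j j' => _.
- move: (sq i j j'); set s := G i j * G i j' => s2.
  rewrite (_ : _ * _ = s ^+ 2 * (z + w + z * w) ^+ 2); last by ring.
  by rewrite s2 addzw mulzw; ring.
- rewrite -!expr2 !Gsq mulr1n.
  rewrite (_ : _ * _ = (8 + (z + w)) ^+ 2); last by ring.
  by rewrite addzw; ring.
move: (sq i j j') (sq i' j j'); set s := G i j * _; set t := G i' j * _ => s2 t2.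
rewrite (_ : _ * _ = (s ^+ 2 + t ^+ 2) * (z * w)
  + s * t * (z ^+ 2 + w ^+ 2)); last by ring.
by rewrite s2 t2 mulzw addzw2; ring.
Qed.

Lemma SIC_vec_tight :
  \sum_(ij : 'I_d * 'I_d) SIC_vec im H ij.1 ij.2
     *m conj_trmx im (SIC_vec im H ij.1 ij.2) = (96%:A)%:M :> 'M[L]_d.
Proof.
rewrite -(pair_bigA _ (fun i j : 'I_d =>
  SIC_vec im H i j *m conj_trmx im (SIC_vec im H i j))) /=.
apply/matrixP => k l; rewrite summxE mxE natA.
under eq_bigr => i _.
  rewrite summxE.
  under eq_bigr => j _.
    rewrite mxE big_ord1 SIC_vecE [X in _ * X]mxE [X in _ * X]mxE conj_SIC_vecE.
    rewrite mulrACA.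
    over.
  rewrite -mulr_suml sumG_rows mulrA (eq_sym k i) (eq_sym l i).
  over.
rewrite sum_perturb sumr_const card_ord.
have [_|_] := eqVneq k l; last by rewrite /= !mulr0n mul0rn; ring.
rewrite /= !mulr1n -(mulr_natr d%:R) d8L.
rewrite (_ : _ + _ = 8 * (8 + (z + w) + z * w)); last by ring.
by rewrite addzw mulzw; ring.
Qed.

Lemma SIC_vec_span : (0 < d)%N ->
  <<codom (fun ij : 'I_d * 'I_d => SIC_vec im H ij.1 ij.2)>>%VS
    = {: 'cV[L]_d}%VS.
Proof.
move=> d_gt0; pose i := Ordinal d_gt0.
pose D := diag_mx (\row_k (1 + (k == i)%:R * z)).
have Dunit : D \in unitmx.
  rewrite unitmxE det_diag unitfE; apply/prodf_neq0 => k _; rewrite mxE.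
  by case: (k == i); rewrite ?mul1r ?mul0r ?addr0 ?one_plus_z_neq0 ?oner_eq0.
have Gunit : G \in unitmx.
  have /mulmx1_unit[] // : G *m (d%:R^-1 *: G^T) = 1%:M.
  by rewrite -scalemxAr Grows scale_scalar_mx mulVf.
apply: (@unitmx_cols_span _ _ (D *m G)) => [|j].
  by rewrite unitmx_mul Dunit Gunit.
have -> : col j (D *m G) = SIC_vec im H i j.
  apply/matrixP => k l; rewrite (ord1 l) SIC_vecE mxE mul_diag_mx !mxE.
  by rewrite mulrC.
by apply: memv_span; apply: (codom_f _ (i, j)).
Qed.

End Vectors.

Theorem theorem2 (K : fieldType) (L : fieldExtType K) (im : L) (p d : nat)
    (H : 'M[K]_d) :
  ~ splits ('X^2 + 1 : {poly K}) ->
  adjoins_sqrtN1 im ->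
  (0 < d)%N ->
  is_char K p ->
  d = 8 %[mod p] ->
  modular_hadamard H ->
  is_SIC im 12 16 96 (fun ij : 'I_d * 'I_d => SIC_vec im H ij.1 ij.2).
Proof.
move=> nsp adj d_gt0 charKp d_mod hadH.
have d8 := natr_eq_mod_char charKp d_mod.
split.
- (* The difference [12 ^ 2 - 16] is [2 ^ 7]. *)
  rewrite -subr_eq0 (_ : _ - _ = 2 ^+ 7); last by ring.
  by rewrite expf_neq0 ?nonsplit_two_neq0.
- by rewrite card_prod card_ord mulnn.
- by move=> [i j]; apply: SIC_vec_norm.
- by move=> [i j] [i' j']; apply: SIC_vec_equiangular.
- exact: SIC_vec_tight.
exact: SIC_vec_span.
Qed.
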